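(* Let $\mathfrak G$ and $\mathfrak G'$ be connected simple graphs with $(2,Q)$- and $(2,Q')$-bounded geometry, respectively, and let $\varphi:\mathfrak G\to\mathfrak G'$ be a strict rough isometry. Assume that $1\le p<\infty$ and that $1\le r\le s\le\infty$. The following hold: (i) if $\mathcal M$ is bounded from $L^{p,r}(\mathfrak G)$ to $L^{p,s}(\mathfrak G)$, then $\mathcal M$ is bounded from $L^{p,r}(\mathfrak G')$ to $L^{p,s}(\mathfrak G')$; (ii) if $\mathcal N$ is bounded from $L^{p,r}(\mathfrak G)$ to $L^{p,s}(\mathfrak G)$, then $\mathcal N$ is bounded from $L^{p,r}(\mathfrak G')$ to $L^{p,s}(\mathfrak G')$.
   Context: Simple graphs are undirected graphs without self-loops and multi-edges; a graph is identified with its set of vertices, and $\nu(x)$ is the number of neighbours of $x$. A graph has $(2,Q)$-bounded geometry ($Q$ an integer) if $3\le\nu(x)\le Q+1$ for every vertex $x$. The distance $d(x,y)$ on a connected simple graph is the length of a shortest path joining $x$ and $y$; $\mu$ is the counting measure, $|E|:=\mu(E)$, $B_r(x):=\{y:d(x,y)\le r\}$. With $\mathbb N=\{0,1,2,\dots\}$, on each graph $$\mathcal M f(x):=\sup_{r\in\mathbb N}\frac1{|B_r(x)|}\int_{B_r(x)}|f|\,d\mu,\qquad \mathcal N f(x):=\sup_{B\ni x}\frac1{|B|}\int_B|f|\,d\mu,$$ where the second supremum is over all balls $B$ (of any centre and any radius in $\mathbb N$) containing $x$. Strict rough isometry: for connected simple graphs $\mathfrak G,\mathfrak G'$ with distances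 $d,d'$, a map $\varphi:\mathfrak G\to\mathfrak G'$ is a strict rough isometry if $K:=\max\{d'(\varphi(\mathfrak G),x'):x'\in\mathfrak G'\}$ is finite and there exists a positive number $\beta$ such that $$d(x,y)-\beta\le d'(\varphi(x),\varphi(y))\le d(x,y)+\beta\qquad\text{for all }x,y\in\mathfrak G .$$ Lorentz spaces are with respect to the counting measure: putting $E_f(\lambda):=\{x:|f(x)|>\lambda\}$, the (quasi-)norms are $\|f\|_{L^{p,r}}=\big(p\int_0^\infty |E_f(\lambda)|^{r/p}\lambda^{r-1}\,d\lambda\big)^{1/r}$ for $1\le r<\infty$ and $\|f\|_{L^{p,\infty}}=\sup_{\lambda>0}\lambda|E_f(\lambda)|^{1/p}$. *)

(* Defs.v *)
From HB Require Import structures.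
From mathcomp Require Import all_boot all_order all_algebra.
From mathcomp Require Import all_classical all_reals all_analysis.

Set Implicit Arguments.
Unset Strict Implicit.
Unset Printing Implicit Defensive.

Import Order.TTheory GRing.Theory Num.Theory.

Local Open Scope classical_set_scope.
Local Open Scope ring_scope.

(** The vertex type is a [pointedType] because the library's measurable types
    are pointed; this only excludes the empty graph. *)
Record simple_graph := SimpleGraph {
  node : pointedType;
  adj : rel node;
  adj_sym : symmetric adj;
  adj_irrefl : irreflexive adj }.

(** An alias of [node G], so that the discrete sigma-algebra below is attached
    to the vertices of a graph and not to every pointed type. *)
Definition vertex (G : simple_graph) : Type := node G.
Coercion vertex : simple_graph >-> Sortclass.

HB.instance Definition _ (G : simple_graph) := Pointed.copy (vertex G) (node G).
HB.instance Definition _ (G : simple_graph) :=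
  @isMeasurable.Build default_measure_display (vertex G)
    (@discrete_measurable (vertex G)) (@discrete_measurable0 (vertex G))
    (@discrete_measurableC (vertex G)) (@discrete_measurableU (vertex G)).

Section graph.
Variable G : simple_graph.

Definition neighbours (x : G) : set G := [set y | adj (x : node G) y].

(** [(2, Q)]-bounded geometry, including that every vertex has finitely many
    neighbours. *)
Definition bounded_geometry2 (Q : int) : Prop :=
  forall x : G, exists n : nat,
    [/\ (neighbours x #= `I_n)%card, (3 <= n)%N & (n%:Z <= Q + 1)%R].

Definition joined (x y : G) (n : nat) : Prop :=
  exists w : seq (node G),
    [/\ path (@adj G) x w, last (x : node G) w = y & size w = n].

Definition graph_connected : Prop := forall x y : G, exists n, joined x y n.

(** The least length of a path from [x] to [y]; the default value [0] is only
    used when there is no such path, hence never on a connected graph. *)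
Definition dist (x y : G) : nat :=
  xget 0%N [set n | joined x y n /\ forall m, joined x y m -> (n <= m)%N].

Definition gball (x : G) (r : nat) : set G := [set y | (dist x y <= r)%N].

Variable R : realType.

Definition dist_to_set (A : set G) (x : G) : \bar R :=
  ereal_inf [set (dist a x)%:R%:E | a in A].

Local Open Scope ereal_scope.

Definition average (f : G -> R) (B : set G) : \bar R :=
  (counting B)^-1 * \int[counting]_(y in B) `|f y|%:E.

Definition centred_maximal (f : G -> R) (x : G) : \bar R :=
  ereal_sup [set average f (gball x r) | r in [set: nat]].

Definition uncentred_maximal (f : G -> R) (x : G) : \bar R :=
  ereal_sup [set average f B
            | B in [set B | (exists y r, B = gball y r) /\ B x]].

Definition level_set (g : G -> \bar R) (l : R) : set G :=
  [set x | l%:E < `|g x|].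

(** The functions are extended-real valued since maximal functions may take the
    value [+oo]; [-oo] is a junk value of the second exponent. *)
Definition lorentz_norm (p : R) (r : \bar R) (g : G -> \bar R) : \bar R :=
  match r with
  | r%:E =>
      (p%:E * \int[lebesgue_measure]_(l in `]0%R, +oo[)
                (counting (level_set g l) `^ (r / p) * (l `^ (r - 1))%:E))
        `^ r^-1
  | +oo =>
      ereal_sup [set l%:E * counting (level_set g l) `^ p^-1
                | l in `]0%R, +oo[]
  | -oo => 0
  end.

Definition lorentz_bounded (T : (G -> R) -> G -> \bar R)
    (p : R) (r s : \bar R) : Prop :=
  exists2 C : R, (0 <= C)%R &
    forall f : G -> R, lorentz_norm p r (EFin \o f) < +oo ->
      lorentz_norm p s (T f) <= C%:E * lorentz_norm p r (EFin \o f).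

End graph.

Arguments centred_maximal {G R}.
Arguments uncentred_maximal {G R}.

Definition strict_rough_isometry (R : realType) (G G' : simple_graph)
    (phi : G -> G') : Prop :=
  (ereal_sup (range (dist_to_set R (range phi))) < +oo)%E /\
  exists2 beta : R, 0 < beta &
    forall x y : G,
      (dist x y)%:R - beta <= (dist (phi x) (phi y))%:R <= (dist x y)%:R + beta.

(* Main.v *)
From HB Require Import structures.
Require Import Defs.
From mathcomp Require Import all_boot all_order all_algebra finmap.
From mathcomp Require Import all_classical all_reals all_analysis.
From mathcomp Require Import measurable_realfun zify lra.

Set Implicit Arguments.
Unset Strict Implicit.
Unset Printing Implicit Defensive.

Import Order.TTheory GRing.Theory Num.Theory.
Local Open Scope classical_set_scope.

(** A strict rough isometry [phi : G -> G'] has a rough inverse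
    [psi : G' -> G], and both maps distort distances by at most an additive
    constant [c].  The additive (rather than multiplicative) error is what makes
    the argument work: [psi] sends the ball of radius [r] about [x'] into the
    ball of radius [r + c] about [psi x'], and since degrees are bounded,
    enlarging a radius by a constant multiplies the cardinality of a ball by at
    most a constant, uniformly in [r].  Hence these two balls have comparable
    cardinalities ([counting_gball_near]).

    Given [f] on [G'], let [F x] be the maximum of [|f|] over the fibre of
    [psi] at [x].  Fibres of [psi] have diameter at most [c], so they have
    boundedly many points, and the average of [|f|] over a ball of [G'] is at
    most a constant times the average of [F] over the corresponding ball of [G]
    ([average_near]).  Taking suprema over balls gives [T' f <= A * T F o psi]
    pointwise, when [T] and [T'] are the centred maximal operators, and likewise
    when they are the uncentred ones.

    It remains to compare norms.  The level sets of [F] are contained in the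
    images under [psi] of those of [f], so the norm of [F] is at most that of
    [f]; the level sets of [T' f] are contained in the preimages under [psi] of
    those of [T F] at a proportional height, so the norm of [T' f] is at most a
    constant times that of [T F].  Both comparisons are instances of
    [lorentz_norm_dilate], which turns a bound between distribution functions,
    up to a constant factor and a dilation of the height, into a bound between
    Lorentz norms.  Applying the hypothesis on [T] to [F] closes the chain,
    with a constant independent of [f]. *)

(** * Counting *)

Section counting.
Variable R : realType.
Local Open Scope ereal_scope.

Lemma le_counting_fset (T : choiceType) (A : set T) (n : nat) :
  @counting T R A <= n%:R%:E <-> finite_set A /\ (#|` fset_set A| <= n)%N.
Proof.
rewrite /counting; case: asboolP => finA; last first.
  by split=> [|[]]; rewrite ?leye_eq.
by rewrite lee_fin ler_nat; split=> [|[]].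
Qed.

Lemma le_counting (T : choiceType) (A B : set T) :
  A `<=` B -> @counting T R A <= counting B.
Proof.
move=> AB; rewrite /counting.
case: (asboolP (finite_set B)) => finB; last exact: leey.
have finA := sub_finite_set AB finB.
by rewrite asboolT// lee_fin ler_nat fsubset_leq_card// -fset_set_sub.
Qed.

Lemma counting_ge0 (T : choiceType) (A : set T) : 0 <= @counting T R A.
Proof. by rewrite /counting; case: ifP => _; rewrite ?lee_fin// leey. Qed.

Lemma counting_set1 (T : choiceType) (x : T) : @counting T R [set x] = 1.
Proof. by rewrite /counting asboolT// fset_set1 cardfs1. Qed.

(** The single counting principle behind every cardinality estimate below:
    growth of balls, comparison of balls in the two graphs, and comparison of
    level sets are all bounded-to-one coverings. *)
Lemma counting_cover (T U : choiceType) (A : set T) (B : set U)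
    (F : U -> set T) (N : nat) : (0 < N)%N ->
  A `<=` \bigcup_(u in B) F u ->
  (forall u, B u -> counting (F u) <= N%:R%:E :> \bar R) ->
  counting A <= N%:R%:E * counting B :> \bar R.
Proof.
move=> N0 AF cF.
have [finB|infB] := pselect (finite_set B); last first.
  by rewrite [counting B]/counting asboolF// gt0_muley ?leey// lte_fin ltr0n.
(* Induction over an enumeration of [B], removing [F u] from the covered set at
   each step. *)
have key (s : seq U) (D : set T) : D `<=` \bigcup_(u in [set` s]) F u ->
    (forall u, u \in s -> counting (F u) <= N%:R%:E :> \bar R) ->
    finite_set D /\ (#|` fset_set D| <= N * size s)%N.
  elim: s D => [|u s IHs] D DF cs.
    have -> : D = set0 by apply/seteqP; split=> // x /DF[].
    by split=> //; rewrite fset_set0.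
  have [] := IHs (D `\` F u).
    move=> x [Dx nFx]; have [v /= /[!inE] /predU1P[->//|vs] Fvx] := DF x Dx.
    by exists v.
  - by move=> v vs; apply: cs; rewrite inE vs orbT.
  move=> fin1 card1.
  have /le_counting_fset[fin2 card2] := cs u (mem_head _ _).
  have Dsub : D `<=` F u `|` (D `\` F u).
    by move=> x Dx; case: (pselect (F u x)); [left|right].
  have finU : finite_set (F u `|` (D `\` F u)) by rewrite finite_setU.
  have finD := sub_finite_set Dsub finU.
  split=> //; rewrite /= mulnS (leq_trans _ (leq_add card2 card1))//.
  apply: leq_trans (fsubset_leq_card _) (leq_card_fsetU _ _).
  by rewrite -fset_setU// -fset_set_sub.
rewrite [counting B]/counting asboolT// -EFinM -natrM.
apply/le_counting_fset; apply: key => [x /AF[u Bu Fux]|u].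
  by exists u => //=; rewrite in_fset_set// inE.
by rewrite in_fset_set// inE => /cF.
Qed.

End counting.

(** * The graph metric *)

Section metric.
Variable G : simple_graph.
Implicit Types x y z : G.

Lemma joined0 x : joined x x 0.
Proof. by exists [::]. Qed.

Lemma joined_sym x y n : joined x y n -> joined y x n.
Proof.
move=> [w [pw <- <-]]; exists (rev (belast (x : node G) w)); split.
- by rewrite rev_path; under eq_path do rewrite adj_sym.
- by case: w {pw} => //= a w; rewrite rev_cons last_rcons.
- by rewrite size_rev size_belast.
Qed.

Lemma joined_trans x y z m n : joined x y m -> joined y z n ->
  joined x z (m + n).
Proof.
move=> [w [pw lw <-]] [w' [pw' lw' <-]]; exists (w ++ w').
by rewrite cat_path last_cat size_cat lw pw pw' lw'.
Qed.

Lemma joined_split x y m n : joined x y (m + n) ->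
  exists2 z, joined x z m & joined z y n.
Proof.
move=> [w [+ + sw]]; rewrite -(cat_take_drop m w) cat_path last_cat.
move=> /andP[p1 p2] l; exists (last (x : node G) (take m w)).
  by exists (take m w); split=> //; rewrite size_takel// sw leq_addr.
by exists (drop m w); split=> //; rewrite size_drop sw addKn.
Qed.

Hypothesis connG : graph_connected G.

Lemma dist_spec x y :
  joined x y (dist x y) /\ forall m, joined x y m -> (dist x y <= m)%N.
Proof.
rewrite /dist; case: xgetP => [n _ //|none].
(* The default value of [dist] is excluded: lengths of paths have a minimum. *)
have [n xyn] := connG x y.
have exP : exists n, `[< joined x y n >] by exists n; apply/asboolP.
case: (ex_minnP exP) => k /asboolP xyk kmin.
by case: (none k); split=> // m xym; apply: kmin; apply/asboolP.
Qed.

Lemma joined_dist x y : joined x y (dist x y).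
Proof. by case: (dist_spec x y). Qed.

Lemma dist_le x y n : joined x y n -> (dist x y <= n)%N.
Proof. by case: (dist_spec x y) => _; apply. Qed.

Lemma dist_refl x : dist x x = 0%N.
Proof. by apply/eqP; rewrite -leqn0; apply/dist_le/joined0. Qed.

Lemma dist_sym x y : dist x y = dist y x.
Proof.
by apply/eqP; rewrite eqn_leq !dist_le//; apply/joined_sym/joined_dist.
Qed.

Lemma dist_triangle y x z : (dist x z <= dist x y + dist y z)%N.
Proof. by apply/dist_le/joined_trans; exact: joined_dist. Qed.

(** A point at distance at most [r + k] from [x] is within [k] of some point
    of the smaller ball: cut a geodesic after [r] steps. *)
Lemma gball_cover x r k :
  gball x (r + k) `<=` \bigcup_(z in gball x r) gball z k.
Proof.
move=> y /= xy; have [xyr|rxy] := leqP (dist x y) r.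
  by exists y => //; rewrite /gball/= dist_refl.
have : joined x y (r + (dist x y - r)).
  by rewrite subnKC 1?ltnW//; exact: joined_dist.
move=> /joined_split[z xz zy]; exists z; first exact: dist_le.
by rewrite /gball/= (leq_trans (dist_le zy))// leq_subLR.
Qed.

Variable R : realType.
Local Open Scope ereal_scope.

(** With degrees at most [Q + 1], unit balls have at most [Q + 2] points, and
    covering a ball by unit balls gives growth at most exponential. *)
Lemma bounded_geometry2_gball (Q : int) : bounded_geometry2 G Q ->
  exists2 D : nat, (0 < D)%N &
    forall k x, counting (gball x k) <= (D ^ k)%:R%:E :> \bar R.
Proof.
move=> geomG; pose D := (absz (Q + 1)%R).+1; exists D => // k x.
elim: k x => [|k IHk] x.
  rewrite expn0 (le_trans (@le_counting R _ _ [set x] _)) ?counting_set1//.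
  move=> y /=; rewrite /gball/= leqn0 => /eqP dxy.
  by have := joined_dist x y; rewrite dxy => -[[|a w]] [_ //= ->].
rewrite expnS natrM EFinM -(addn1 k).
apply: (@le_trans _ _ (D%:R%:E * counting (gball x k))); last first.
  by rewrite lee_pmul2l// lte_fin ltr0n.
apply: counting_cover (@gball_cover x k 1) _ => // y _.
have sub : gball y 1 `<=` [set y] `|` neighbours y.
  move=> z; rewrite /gball/= leq_eqVlt ltnS leqn0 => /predU1P[|/eqP] dyz;
    have := joined_dist y z; rewrite dyz.
    by move=> [[|a [|b w]]] [//= /andP[ya _] <-]; right.
  by move=> [[|a w]] [_ //= ->]; left.
have [n [cardn _ nQ]] := geomG y.
have finn : finite_set (neighbours y) by exists n.
apply: le_trans (le_counting R sub) _.
apply/le_counting_fset; split; first by rewrite finite_setU.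
rewrite fset_setU// (leq_trans (leq_card_fsetU _ _))// fset_set1 cardfs1.
rewrite ltnS (card_fset_set cardn); lia.
Qed.

End metric.

(** * Maps that distort distances by an additive constant *)

(** A natural number as additive constant keeps all later estimates on radii in
    integer arithmetic. *)
Definition near_isometric (G G' : simple_graph) (c : nat)
    (phi : G -> G') : Prop :=
  forall x y, (dist (phi x) (phi y) <= dist x y + c)%N /\
              (dist x y <= dist (phi x) (phi y) + c)%N.

Section rough_inverse.
Variables (R : realType) (G G' : simple_graph).
Hypothesis connG' : graph_connected G'.
Variable phi : G -> G'.
Hypothesis hphi : strict_rough_isometry R phi.

Lemma strict_rough_isometry_near : exists c, near_isometric c phi.
Proof.
have [_ [b b0 hb]] := hphi; exists (Num.bound b) => x y.
have /andP[lo hi] := hb x y.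
have bB : (b < (Num.bound b)%:R)%R by rewrite archi_boundP// ltW.
by split; rewrite -(ler_nat R) natrD; lra.
Qed.

Lemma strict_rough_isometry_cobounded :
  exists K, forall x', exists x, (dist (phi x) x' <= K)%N.
Proof.
have [supK _] := hphi.
have [M M0 hM] : exists2 M : R, (0 <= M)%R &
    (ereal_sup (range (dist_to_set R (range phi))) <= M%:E)%E.
  case: ereal_sup supK => [u _| //|_]; last by exists 0%R => //; exact: leNye.
  by exists (Num.max u 0)%R; rewrite ?lee_fin le_max lexx ?orbT.
exists (Num.bound M) => x'; apply: contrapT => far.
suff : ((Num.bound M)%:R%:E <= M%:E :> \bar R)%E.
  by rewrite lee_fin leNgt archi_boundP.
apply: le_trans hM; apply: (@le_trans _ _ (dist_to_set R (range phi) x')).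
  apply: le_ereal_inf_tmp => _ [_ [x _ <-] <-]; rewrite lee_fin ler_nat.
  by rewrite leqNgt; apply/negP => lt; case: far; exists x; exact: ltnW.
by apply: ereal_sup_ubound; exists x'.
Qed.

(** Sending [x'] to a point whose image under [phi] is within [K] of [x']
    inverts [phi] up to a bounded error. *)
Lemma rough_inverse : exists (psi : G' -> G) c,
  [/\ near_isometric c phi, near_isometric c psi &
      forall x', (dist (phi (psi x')) x' <= c)%N].
Proof.
have [b hb] := strict_rough_isometry_near.
have [K /choice[psi hpsi]] := strict_rough_isometry_cobounded.
exists psi, (b + K + K)%N; split=> [x y|x y|x].
- by have [] := hb x y; lia.
- have [] := hb (psi x) (psi y); have := hpsi x; have := hpsi y.
  have := dist_triangle connG' x (phi (psi x)) (phi (psi y)).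
  have := dist_triangle connG' y x (phi (psi y)).
  have := dist_triangle connG' (phi (psi x)) x y.
  have := dist_triangle connG' (phi (psi y)) (phi (psi x)) y.
  rewrite (dist_sym connG' x (phi (psi x))) (dist_sym connG' y (phi (psi y))).
  by lia.
- by have := hpsi x; lia.
Qed.

End rough_inverse.

Section near_isometric_counting.
Variables (R : realType) (G G' : simple_graph) (phi : G -> G') (c N : nat).
Hypothesis connG' : graph_connected G'.
Hypothesis near_phi : near_isometric c phi.
Local Open Scope ereal_scope.
Hypotheses (N0 : (0 < N)%N)
  (ballN : forall x : G, counting (gball x c) <= N%:R%:E :> \bar R).

(** Two points of a fibre are at distance at most [c], so a fibre lies in a ball
    of radius [c] and has at most [N] points. *)
Lemma counting_preimage_near (A : set G') :
  counting (phi @^-1` A) <= N%:R%:E * counting A :> \bar R.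
Proof.
apply: (@counting_cover R _ _ _ _ (fun y => phi @^-1` [set y])) => //.
  by move=> x Ax; exists (phi x).
move=> y _; have [->|/set0P[x phixy]] := eqVneq (phi @^-1` [set y]) set0.
  by rewrite measure0 lee_fin.
apply: le_trans (ballN x); apply: le_counting => z /= phizy.
by have [_] := near_phi x z; rewrite phixy phizy dist_refl.
Qed.

(** The push-forward by [phi] of the counting measure is at most [N] times the
    counting measure, again because fibres have at most [N] points. *)
Lemma integral_near (f : G -> R) (F : G' -> R) (A : set G) (B : set G') :
  A `<=` phi @^-1` B -> (forall x, `|f x| <= `|F (phi x)|)%R ->
  \int[counting]_(x in A) `|f x|%:E
  <= N%:R%:E * \int[counting]_(y in B) `|F y|%:E.
Proof.
move=> AB fF.
have mB : measurable B by [].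
have mall' (g : G' -> \bar R) D : measurable_fun D g by [].
apply: (@le_trans _ _ (\int[counting]_(x in phi @^-1` B) `|F (phi x)|%:E)).
  apply: (@le_trans _ _ (\int[counting]_(x in A) `|F (phi x)|%:E)).
    by apply: ge0_le_integral => // x _; rewrite ?lee_fin.
  by apply: ge0_subset_integral => // x _; rewrite lee_fin.
have mphi : measurable_fun setT phi by [].
pose nu : {measure set G' -> \bar R}%R := @pushforward _ _ G G' R counting phi.
pose N' : {nonneg R}%R := NngNum (ler0n R N).
rewrite -(@ge0_integral_pushforward _ _ G G' R phi mphi counting B
  (fun y => `|F y|%:E) mB (mall' _ _))//.
rewrite -(@ge0_integral_mscale _ _ R counting _ mB N' _ (mall' _ _))//.
apply: (@ge0_le_measure_integral _ _ R (nu mphi) (mscale N' counting)) => //.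
by move=> S _; exact: counting_preimage_near.
Qed.

End near_isometric_counting.

(** * Dilations and Lorentz norms *)

Section scaling.
Variable R : realType.
Local Open Scope ereal_scope.
Local Notation mu := (@lebesgue_measure R).

(** Superlevel sets of a nonincreasing function are intervals. *)
Lemma measurable_nonincreasing_ereal (D : set R) (f : R -> \bar R) :
  measurable D -> {homo f : x y / (x <= y)%R >-> y <= x} -> measurable_fun D f.
Proof.
move=> mD nif.
apply: (measurability (@ErealGenCInfty.G R)) => [|/= _ [_] [r] -> <-].
  exact: ErealGenCInfty.measurableE.
apply: measurableI => //; apply: is_interval_measurable => s t/=.
rewrite !in_itv/= !andbT => fs ft u /andP[su ut].
by rewrite in_itv/= andbT (le_trans ft)// nif.
Qed.

(** The push-forward of the Lebesgue measure by the contraction, scaled by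
    [c^-1], has the right value on intervals, so uniqueness of the Lebesgue
    measure applies. *)
Lemma lebesgue_measure_dilate (c : R) (A : set (measurableTypeR R)) :
  (0 < c)%R -> measurable A -> mu ((fun x => c^-1 * x)%R @^-1` A) = c%:E * mu A.
Proof.
move=> c0 mA.
have mphi : measurable_fun [set: measurableTypeR R]
    (fun x : R => c^-1 * x : measurableTypeR R)%R.
  exact: measurable_funM.
pose phi : {mfun measurableTypeR R >-> measurableTypeR R} :=
  HB.pack (fun x : R => c^-1 * x : measurableTypeR R)%R
    (isMeasurableFun.Build _ _ _ _ _ mphi).
have ci0 : (0 <= c^-1)%R by rewrite invr_ge0 ltW.
rewrite (@lebesgue_measure_unique R
  (mscale (NngNum ci0) (pushforward mu phi)) _ A mA).
  by rewrite /mscale/= /pushforward/= muleA -EFinM divff ?mul1e// gt_eqF.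
move=> _ [[a b] _ <-] /=.
rewrite (_ : mscale _ _ _ =
  c^-1%:E * mu ((fun x => c^-1 * x)%R @^-1` `]a, b]%classic))//.
have -> : (fun x => c^-1 * x)%R @^-1` `]a, b]%classic =
          `](c * a)%R, (c * b)%R]%classic.
  apply/seteqP; split=> x /=; rewrite !in_itv/= ![(c^-1 * _)%R]mulrC;
    rewrite ltr_pdivlMr// ler_pdivrMr//;
    by rewrite (mulrC a) (mulrC b).
rewrite !lebesgue_measure_itv/= !lte_fin ltr_pM2l//.
case: ifP => _; last by rewrite mule0.
by rewrite -!EFinD -EFinM -mulrBr mulKf// gt_eqF.
Qed.

Lemma integral_dilate (c : R) (h : R -> \bar R) : (0 < c)%R ->
  measurable_fun (`]0%R, +oo[%classic : set R) h -> (forall l, 0 <= h l) ->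
  \int[mu]_(l in `]0%R, +oo[) h (c^-1 * l)%R
  = c%:E * \int[mu]_(l in `]0%R, +oo[) h l.
Proof.
move=> c0 mh h0.
have mphi : measurable_fun [set: measurableTypeR R]
    (fun x : R => c^-1 * x : measurableTypeR R)%R.
  exact: measurable_funM.
pose D : set (measurableTypeR R) := `]0%R, +oo[%classic.
have mD : measurable D by exact: measurable_itv.
have := @ge0_integral_pushforward _ _
  (measurableTypeR R) (measurableTypeR R) R _ mphi mu D h mD mh
  (fun y _ => h0 y).
have -> : (fun x => c^-1 * x)%R @^-1` D = D.
  apply/seteqP; split=> x /=;
    by rewrite /D/= !in_itv/= !andbT pmulr_rgt0 ?invr_gt0.
move=> <-.
have c0' := ltW c0.
rewrite -(@ge0_integral_mscale _ _ R mu _ mD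
  (NngNum c0') h mh (fun y _ => h0 y)).
apply: eq_measure_integral => A mA _.
exact: lebesgue_measure_dilate.
Qed.

End scaling.

Section lorentz.
Variable R : realType.
Local Open Scope ereal_scope.
Local Notation mu := (@lebesgue_measure R).

(** Measurability holds for every [g] because distribution functions are
    nonincreasing. *)
Lemma measurable_lorentz_integrand (G : simple_graph) (g : G -> \bar R)
    (p r : R) (D : set R) : measurable D ->
  measurable_fun D (fun l : R =>
    counting (level_set g l) `^ (r / p) * (l `^ (r - 1))%:E).
Proof.
move=> mD; apply: emeasurable_funM; last first.
  apply/measurable_EFinP/measurable_funTS; exact: measurable_powR.
apply: (measurableT_comp (measurable_poweR _)).
apply: measurable_nonincreasing_ereal => // l m lm; apply: le_counting.
by move=> x; rewrite /level_set/=; apply: le_lt_trans; rewrite lee_fin.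
Qed.

(** The constant comes from the homogeneity of the norm: a factor [N] on the
    distribution function enters to the power [1 / p], and the substitution
    [l = c * m] produces [c ^ r] inside the integral, hence [c] after the
    [r]-th root; in the weak norm it produces [c] directly. *)
Lemma lorentz_norm_dilate (G G' : simple_graph) (g : G -> \bar R)
    (g' : G' -> \bar R) (p N c : R) (r : \bar R) :
  (0 < p)%R -> (0 <= N)%R -> (0 < c)%R -> 0 < r ->
  (forall l, (0 < l)%R -> counting (level_set g' l) <=
                         N%:E * counting (level_set g (c^-1 * l)%R)) ->
  lorentz_norm p r g' <= (N `^ p^-1 * c)%:E * lorentz_norm p r g.
Proof.
move=> p0 N0 c0 + gg'.
have powle (q l : R) : (0 <= q)%R -> (0 < l)%R ->
    counting (level_set g' l) `^ q <=
    (N `^ q)%:E * counting (level_set g (c^-1 * l)%R) `^ q.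
  move=> q0 l0; rewrite -poweR_EFin -poweRM ?lee_fin ?counting_ge0//.
  apply: gt0_ler_poweR (gg' _ l0) => //;
    rewrite in_itv/= leey andbT ?counting_ge0//.
  by rewrite mule_ge0 ?counting_ge0// lee_fin.
have cl0 l : (0 < l)%R -> (0 < c^-1 * l)%R.
  by move=> l0; rewrite mulr_gt0 ?invr_gt0.
have lE l : (l = c * (c^-1 * l))%R by rewrite mulVKf// gt_eqF.
case: r => [r| |//] r0 /=; last first.
  apply: ge_ereal_sup => _ [l /= + <-]; rewrite in_itv/= andbT => l0.
  apply: (@le_trans _ _ ((N `^ p^-1 * c)%:E *
      ((c^-1 * l)%:E * counting (level_set g (c^-1 * l)%R) `^ p^-1))).
    rewrite muleA -EFinM -mulrA -lE [(_ * l)%R]mulrC EFinM -muleA.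
    by apply: lee_wpmul2l; rewrite ?powle ?invr_ge0 ?lee_fin// ltW.
  apply: lee_wpmul2l; first by rewrite lee_fin mulr_ge0 ?powR_ge0 ?ltW.
  apply: ereal_sup_ubound; exists (c^-1 * l)%R => //=.
  by rewrite in_itv/= andbT cl0.
have {}r0 : (0 < r)%R by rewrite lte_fin in r0.
pose h (l : R) := counting (level_set g l) `^ (r / p) * (l `^ (r - 1))%:E.
have h0 l : 0 <= h l by rewrite mule_ge0 ?poweR_ge0// lee_fin powR_ge0.
have mh (D : set R) : measurable D -> measurable_fun D h.
  exact: measurable_lorentz_integrand.
pose K := (N `^ (r / p) * c `^ (r - 1))%R.
have K0 : (0 <= K)%R by rewrite mulr_ge0 ?powR_ge0.
have int0 (f : R -> \bar R) : (forall l, 0 <= f l) ->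
    0 <= \int[mu]_(l in `]0%R, +oo[) f l by move=> f0; exact: integral_ge0.
have Kc : (K * c = (N `^ p^-1 * c) `^ r)%R.
  rewrite powRM ?powR_ge0 ?ltW// -powRrM mulrC (mulrC p^-1%R) /K.
  by rewrite mulrCA mulr_powRB1// ltW.
apply: (@le_trans _ _ (((((N `^ p^-1 * c) `^ r)%R)%:E *
    (p%:E * \int[mu]_(l in `]0%R, +oo[) h l)) `^ r^-1)).
  apply: gt0_ler_poweR; rewrite ?invr_ge0 ?in_itv/= ?leey ?andbT//.
  - exact: ltW.
  - apply: mule_ge0; first by rewrite lee_fin ltW.
    by apply: int0 => l; apply: mule_ge0; rewrite ?poweR_ge0// lee_fin powR_ge0.
  - apply: mule_ge0; first by rewrite lee_fin powR_ge0.
    by apply: mule_ge0; [rewrite lee_fin ltW|apply: int0].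
  rewrite muleCA lee_pmul2l// -Kc EFinM -muleA -integral_dilate//; last first.
    exact: mh.
  have mhc : measurable_fun (`]0%R, +oo[%classic : set R)
      (fun l => h (c^-1 * l)%R).
    apply: (measurableT_comp (mh setT measurableT)).
    by apply: measurable_funM.
  rewrite -ge0_integralZl_EFin//.
  apply: ge0_le_integral => //.
  - by move=> l _; rewrite mule_ge0 ?poweR_ge0// lee_fin powR_ge0.
  - exact: measurable_lorentz_integrand.
  - exact: measurable_funeM.
  move=> l /=; rewrite in_itv/= andbT => l0.
  rewrite /h; have -> : (l `^ (r - 1) = c `^ (r - 1) * (c^-1 * l) `^ (r - 1))%R.
    by rewrite -powRM -?lE// ltW// cl0.
  rewrite /K !EFinM muleACA !muleA.
  apply: lee_wpmul2r; first by rewrite lee_fin powR_ge0.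
  apply: lee_wpmul2r; first by rewrite lee_fin powR_ge0.
  by rewrite powle// divr_ge0 ?ltW.
rewrite poweRM ?lee_fin ?powR_ge0// ?mule_ge0 ?lee_fin ?(ltW p0)// ?int0//.
rewrite poweR_EFin -powRrM divff ?gt_eqF// powRr1//.
by rewrite mulr_ge0 ?powR_ge0 ?ltW.
Qed.

End lorentz.

(** * Transferring the maximal operators *)

Section averages.
Variables (R : realType) (G : simple_graph).
Local Open Scope ereal_scope.

Lemma average_ge0 (f : G -> R) (B : set G) : 0 <= average f B.
Proof.
apply: mule_ge0; first by rewrite inve_ge0 counting_ge0.
by apply: integral_ge0 => y _; rewrite lee_fin.
Qed.

Hypothesis connG : graph_connected G.

Lemma centred_maximal_ge0 (f : G -> R) x : 0 <= centred_maximal f x.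
Proof.
apply: le_trans (average_ge0 f (gball x 0)) _.
by apply: ereal_sup_ubound; exists 0%N.
Qed.

Lemma uncentred_maximal_ge0 (f : G -> R) x : 0 <= uncentred_maximal f x.
Proof.
apply: le_trans (average_ge0 f (gball x 0)) _.
apply: ereal_sup_ubound; exists (gball x 0) => //=; split.
  by exists x, 0%N.
by rewrite /gball/= dist_refl.
Qed.

End averages.

Section fibre_max.
Variables (R : realType) (G G' : simple_graph) (psi : G' -> G).
Local Open Scope ereal_scope.

(** With the maximum of [|f|] over a fibre, rather than its sum, the level set
    of [fibre_max f] at a nonnegative height lies in the image of the level set of
    [f] at the same height.  On an infinite fibre the value is [0], since
    [fset_set] is then empty. *)
Definition fibre_max (f : G' -> R) (x : G) : R :=
  \big[Order.max/0%R]_(y <- fset_set (psi @^-1` [set x])) `|f y|%R.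

Lemma fibre_max_ge0 f x : (0 <= fibre_max f x)%R.
Proof. exact: bigmax_ge_id. Qed.

Lemma le_fibre_max f y : finite_set (psi @^-1` [set psi y]) ->
  (`|f y| <= `|fibre_max f (psi y)|)%R.
Proof.
move=> fin; rewrite [leRHS]ger0_norm ?fibre_max_ge0//.
by apply: (@le_bigmax_seq _ _ _ _ _ y) => //; rewrite in_fset_set// inE.
Qed.

(** A value of [fibre_max f] above [l > 0] is attained by [|f|] on the fibre, so
    the distribution function does not increase. *)
Lemma lorentz_norm_fibre_max (f : G' -> R) (p : R) (r : \bar R) :
  (0 < p)%R -> 0 < r ->
  lorentz_norm p r (EFin \o fibre_max f) <= lorentz_norm p r (EFin \o f).
Proof.
move=> p0 r0.
have := @lorentz_norm_dilate R G' G (EFin \o f) (EFin \o fibre_max f)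
  p 1 1 r p0 ler01 ltr01 r0.
rewrite powR1 mul1r mul1e; apply => l l0.
apply: (@counting_cover R _ _ _ _ (fun y => [set psi y]) 1) => // [x|y _];
  last by rewrite counting_set1.
rewrite /level_set/= invr1 mul1r lte_fin ger0_norm ?fibre_max_ge0// => lx.
apply: contrapT => none; move: lx; rewrite ltNge => /negP; apply.
rewrite /fibre_max big_seq; apply: bigmax_le => [|y]; first exact: ltW.
have [fin|inf] := pselect (finite_set (psi @^-1` [set x])); last first.
  by rewrite /fset_set; case: pselect => // ?; rewrite inE.
rewrite in_fset_set// inE => /= yx; rewrite leNgt; apply/negP => ly.
by apply: none; exists y => //=; rewrite lte_fin.
Qed.

End fibre_max.

Section volume.
Variables (R : realType) (G : simple_graph) (D : nat).
Hypotheses (connG : graph_connected G) (D0 : (0 < D)%N).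
Local Open Scope ereal_scope.
Hypothesis ballD : forall k (x : G),
  counting (gball x k) <= (D ^ k)%:R%:E :> \bar R.

Lemma counting_gballD (x : G) r k :
  counting (gball x (r + k)) <= (D ^ k)%:R%:E * counting (gball x r) :> \bar R.
Proof.
apply: counting_cover (@gball_cover G connG x r k) _.
  by rewrite expn_gt0 D0.
by move=> z _; exact: ballD.
Qed.

Lemma counting_gball_nat (x : G) r :
  exists2 n : nat, (0 < n)%N & counting (gball x r) = n%:R%:E :> \bar R.
Proof.
have : 1 <= counting (gball x r) :> \bar R.
  rewrite -(@counting_set1 R _ x); apply: le_counting => _ ->.
  by rewrite /gball/= dist_refl.
have /le_counting_fset[fin _] := ballD r x.
rewrite /counting asboolT// lee_fin ler1n => n0.
by exists #|` fset_set (gball x r)|.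
Qed.

End volume.

Section transfer.
Variables (R : realType) (G G' : simple_graph) (phi : G -> G') (psi : G' -> G).
Variables (c D D' : nat).
Hypotheses (connG : graph_connected G) (connG' : graph_connected G').
Hypotheses (near_phi : near_isometric c phi) (near_psi : near_isometric c psi).
Hypothesis phi_psi : forall x', (dist (phi (psi x')) x' <= c)%N.
Hypotheses (D0 : (0 < D)%N) (D'0 : (0 < D')%N).
Local Open Scope ereal_scope.
Hypothesis ballD : forall k (x : G),
  counting (gball x k) <= (D ^ k)%:R%:E :> \bar R.
Hypothesis ballD' : forall k (x : G'),
  counting (gball x k) <= (D' ^ k)%:R%:E :> \bar R.

Lemma gball_subset_preimage x' r :
  gball x' r `<=` psi @^-1` gball (psi x') (r + c).
Proof.
move=> y'; rewrite /gball/= => yr; have [+ _] := near_psi x' y'.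
by move=> /leq_trans; apply; rewrite leq_add2r.
Qed.

(** The points near [psi x'] need not be in the image of [psi], so they are
    counted through [phi].  It maps the ball into the ball of radius [r + 3 * c]
    about [x']: one [c] is already in the radius, one is the distortion of
    [phi], and one is the distance from [x'] to [phi (psi x')]. *)
Lemma counting_gball_near x' r :
  counting (gball (psi x') (r + c)) <=
  (D ^ c * D' ^ (3 * c))%:R%:E * counting (gball x' r) :> \bar R.
Proof.
have sub : gball (psi x') (r + c) `<=` phi @^-1` gball x' (r + 3 * c).
  move=> x; rewrite /gball/= => xr.
  have := dist_triangle connG' (phi (psi x')) x' (phi x).
  have [+ _] := near_phi (psi x') x; have := phi_psi x'.
  by rewrite (dist_sym connG' x' (phi (psi x'))); lia.
apply: le_trans (le_counting R sub) _.
apply: le_trans (counting_preimage_near connG' near_phi _ (ballD c) _) _.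
  by rewrite expn_gt0 D0.
rewrite natrM EFinM -muleA; apply: lee_wpmul2l; first by rewrite lee_fin.
exact: counting_gballD.
Qed.

(** The first factor bounds the fibres of [psi], the second compares balls. *)
Let A := (D' ^ c * (D ^ c * D' ^ (3 * c)))%N.

Lemma average_near (f : G' -> R) x' r :
  average f (gball x' r) <=
  A%:R%:E * average (fibre_max psi f) (gball (psi x') (r + c)).
Proof.
have [n' n'0 cn'] := counting_gball_nat connG' ballD' x' r.
have [n n0 cn] := counting_gball_nat connG ballD (psi x') (r + c).
have := counting_gball_near x' r.
rewrite /average cn' cn -EFinM lee_fin => nn'.
rewrite !inver !pnatr_eq0 (gtn_eqF n0) (gtn_eqF n'0).
have Dc0 : (0 < D' ^ c)%N by rewrite expn_gt0 D'0.
have finf y : finite_set (psi @^-1` [set psi y]).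
  have := counting_preimage_near connG near_psi Dc0 (ballD' c) [set psi y].
  rewrite counting_set1 mule1.
  by move=> /le_counting_fset[].
have If := integral_near connG near_psi Dc0 (ballD' c)
  (@gball_subset_preimage x' r) (fun y => le_fibre_max f (finf y)).
apply: (@le_trans _ _ (n'%:R^-1%:E * _)).
  by apply: lee_wpmul2l If; rewrite lee_fin.
rewrite !muleA; apply: lee_wpmul2r.
  by apply: integral_ge0 => y _; rewrite lee_fin.
rewrite -!EFinM lee_fin /A natrM -[leRHS]mulrA mulrC ler_wpM2l//.
by rewrite ler_pdivlMr ?ltr0n// mulrC ler_pdivrMr ?ltr0n.
Qed.

Lemma centred_maximal_near (f : G' -> R) x' :
  centred_maximal f x' <= A%:R%:E * centred_maximal (fibre_max psi f) (psi x').
Proof.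
apply: ge_ereal_sup => _ [r _ <-]; apply: le_trans (average_near f x' r) _.
apply: lee_wpmul2l; first by rewrite lee_fin.
by apply: ereal_sup_ubound; exists (r + c)%N.
Qed.

(** A ball about [y] that contains [x'] corresponds to a ball about [psi y] that
    contains [psi x']. *)
Lemma uncentred_maximal_near (f : G' -> R) x' :
  uncentred_maximal f x' <=
  A%:R%:E * uncentred_maximal (fibre_max psi f) (psi x').
Proof.
apply: ge_ereal_sup => _ [_ [[y [r ->]] yx'] <-].
apply: le_trans (average_near f y r) _.
apply: lee_wpmul2l; first by rewrite lee_fin.
apply: ereal_sup_ubound; exists (gball (psi y) (r + c)) => //; split.
  by exists (psi y), (r + c)%N.
exact: gball_subset_preimage yx'.
Qed.

(** The two maximal operators enter only through nonnegativity and the pointwise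
    bound, so they are treated together. *)
Lemma lorentz_bounded_near (T : (G -> R) -> G -> \bar R)
    (T' : (G' -> R) -> G' -> \bar R) (p : R) (r s : \bar R) :
  (0 < p)%R -> 0 < r -> 0 < s ->
  (forall f x, 0 <= T f x) -> (forall f x, 0 <= T' f x) ->
  (forall f x', T' f x' <= A%:R%:E * T (fibre_max psi f) (psi x')) ->
  lorentz_bounded T p r s -> lorentz_bounded T' p r s.
Proof.
move=> p0 r0 s0 T0 T'0 TT' [C C0 bT].
pose B := (((D' ^ c)%:R `^ p^-1) * A%:R)%R.
have B0 : (0 <= B)%R by rewrite mulr_ge0 ?powR_ge0.
have A0 : (0 < A%:R :> R)%R by rewrite ltr0n !muln_gt0 !expn_gt0 D0 D'0.
exists (B * C)%R; first exact: mulr_ge0.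
move=> f finf; set F := fibre_max psi f.
have Ff := lorentz_norm_fibre_max psi f p0 r0.
apply: (@le_trans _ _ (B%:E * lorentz_norm p s (T F))).
  apply: lorentz_norm_dilate => // l l0.
  apply: le_trans (counting_preimage_near connG near_psi _ (ballD' c) _).
    apply: le_counting => x'; rewrite /level_set/= !gee0_abs// => lx.
    rewrite -(@lte_pmul2l _ A%:R%:E) ?lte_fin// -EFinM mulVKf ?gt_eqF//.
    exact: lt_le_trans lx (TT' _ _).
  by rewrite expn_gt0 D'0.
rewrite (EFinM B C) -muleA; apply: lee_wpmul2l; first by rewrite lee_fin.
apply: le_trans (bT F (le_lt_trans Ff finf)) _.
by apply: lee_wpmul2l; rewrite ?lee_fin.
Qed.

End transfer.

Theorem theorem5p3 (R : realType) (G G' : simple_graph) (Q Q' : int)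
    (connG : graph_connected G) (connG' : graph_connected G')
    (geomG : bounded_geometry2 G Q) (geomG' : bounded_geometry2 G' Q')
    (phi : G -> G') (hphi : strict_rough_isometry R phi)
    (p : R) (r s : \bar R)
    (hp : (1 <= p)%R) (hr : (1 <= r)%E) (hrs : (r <= s)%E) :
  (lorentz_bounded (G := G) centred_maximal p r s ->
   lorentz_bounded (G := G') centred_maximal p r s) /\
  (lorentz_bounded (G := G) uncentred_maximal p r s ->
   lorentz_bounded (G := G') uncentred_maximal p r s).
Proof.
have [D D0 ballD] := bounded_geometry2_gball connG R geomG.
have [D' D'0 ballD'] := bounded_geometry2_gball connG' R geomG'.
have [psi [c [near_phi near_psi phi_psi]]] := rough_inverse connG' hphi.
have p0 : (0 < p)%R := lt_le_trans ltr01 hp.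
have r0 : (0 < r)%E := lt_le_trans lte01 hr.
have s0 : (0 < s)%E := lt_le_trans r0 hrs.
split; apply: (lorentz_bounded_near connG near_psi D0 D'0 ballD') => //.
- exact: centred_maximal_ge0.
- exact: centred_maximal_ge0.
- exact: centred_maximal_near near_phi _ _ _ _ _ _.
- exact: uncentred_maximal_ge0.
- exact: uncentred_maximal_ge0.
- exact: uncentred_maximal_near near_phi _ _ _ _ _ _.
Qed.
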